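(* Let $M$ be a manifold of dimension $pq$ carrying an almost Grassmann structure $AG(p-1,p+q-1)$, with structure functions $a=\{a^{i\beta\gamma}_{\alpha jk}\}$, $b^1=\{b^{i\gamma\delta}_{jkl}\}$, $b^2=\{b^{\beta\gamma\delta}_{\alpha kl}\}$. If $p>2$ and $q>2$, then the components of $b^2$ and $b^1$ are expressed in terms of the components of the tensor $a$ and their Pfaffian derivatives; that is, they are given by universal formulas (the same for all such structures with given $p,q$) in the components $a^{i\beta\gamma}_{\alpha jk}$ and the Pfaffian derivatives $a^{i\beta\gamma\delta}_{\alpha jkl}$.
   Context: Index ranges: $\alpha,\beta,\ldots=1,\dots,p$; $i,j,\ldots=p+1,\dots,p+q$; summation over repeated indices; everything real and smooth; $p,q\ge 2$ in general. Almost Grassmann structure: for $\dim M=pq$, an almost Grassmann structure $AG(p-1,p+q-1)$ is a smooth field of Segre cones $SC_x(p,q)\subset T_x(M)$. That is, locally there are smooth (adapted) frames $\{e_i^\alpha\}$ with dual coframe $\omega_\alpha^i$ such that $SC_x(p,q)=\{z=z^i_\alpha e_i^\alpha:\ z^i_\alpha=t_\alpha s^i \text{ for some } t_\alpha,s^i\}$. Adapted frames are related by $'e_i^\alpha=A_\beta^\alpha A_i^je_j^\beta$ with nonsingular matrices $(A^\alpha_\beta)$, $(A_i^j)$, giving the structure group $G=\mathbf{SL}(p)\times\mathbf{SL}(q)\times\mathbf{H}$, where $\mathbf{H}$ is the group of homotheties. Structure equations: the specialized (reduced) higher-order frames of the structure form a bundle over $M$ of dimension $2pq+p^2+q^2-1$.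 It carries the basis forms $\omega_\alpha^i$ (coframe forms of adapted frames), together with fiber 1-forms $\omega_\alpha^\beta,\ \omega_j^i$ (with $\omega_\gamma^\gamma=0$, $\omega_k^k=0$), $\omega$, and $\omega_i^\alpha$. All these forms together span the cotangent spaces and are independent apart from the two trace conditions. They satisfy $$d\omega_\alpha^i-\omega_\alpha^j\wedge\omega_j^i-\omega_\alpha^\beta\wedge\omega_\beta^i-\omega\wedge\omega_\alpha^i=a^{i\beta\gamma}_{\alpha jk}\,\omega_\beta^j\wedge\omega_\gamma^k,$$ $$d\omega_\alpha^\beta-\omega_\alpha^\gamma\wedge\omega_\gamma^\beta=\tfrac{q}{p+q}\bigl(\delta_\alpha^\beta\,\omega_\gamma^k\wedge\omega_k^\gamma-p\,\omega_\alpha^k\wedge\omega_k^\beta\bigr)+b^{\beta\gamma\delta}_{\alpha kl}\,\omega_\gamma^k\wedge\omega_\delta^l,$$ $$d\omega_j^i-\omega_j^k\wedge\omega_k^i=\tfrac{p}{p+q}\bigl(\delta_j^i\,\omega_k^\gamma\wedge\omega_\gamma^k-q\,\omega_j^\gamma\wedge\omega_\gamma^i\bigr)+b^{i\gamma\delta}_{jkl}\,\omega_\gamma^k\wedge\omega_\delta^l,$$ $$d\omega=\omega_i^\alpha\wedge\omega_\alpha^i,$$ $$d\omega_i^\alpha-\omega_i^\beta\wedge\omega_\beta^\alpha-\omega_i^j\wedge\omega_j^\alpha+\omega\wedge\omega_i^\alpha=c^{\alpha\beta\gamma}_{ijk}\,\omega_\gamma^k\wedge\omega_\beta^j-a^{k\alpha\beta}_{\gamma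 ij}\,\omega_k^\gamma\wedge\omega_\beta^j.$$ The specialization of frames is characterized by the following conditions on the structure functions: - $a^{i\beta\gamma}_{\alpha jk}=-a^{i\gamma\beta}_{\alpha kj}$, $a^{i\alpha\gamma}_{\alpha jk}=0$, $a^{i\beta\gamma}_{\alpha ik}=0$; - $b^{\beta\gamma\delta}_{\alpha kl}=-b^{\beta\delta\gamma}_{\alpha lk}$, $b^{i\gamma\delta}_{jkl}=-b^{i\delta\gamma}_{jlk}$, $b^{\alpha\gamma\delta}_{\alpha kl}=0$, $b^{i\gamma\delta}_{ikl}=0$; - $b^{\gamma\alpha\delta}_{\alpha kl}-b^{i\gamma\delta}_{kil}+b^{\delta\alpha\gamma}_{\alpha lk}-b^{i\delta\gamma}_{lik}=0$; - $c^{\alpha\beta\gamma}_{ijk}=-c^{\alpha\gamma\beta}_{ikj}$, and the alternation of $c^{\alpha\beta\gamma}_{ijk}$ over the three index pairs $(\alpha,i),(\beta,j),(\gamma,k)$ vanishes. The tensor $a$ is called the torsion tensor (first structure tensor). Pfaffian derivatives: the Pfaffian derivatives of a function $f$ on this bundle with respect to the basis forms are the coefficients of the forms $\omega_\delta^l$ in the expansion of $df$ in the forms $\omega_\alpha^i$, $\omega_\alpha^\beta$, $\omega_j^i$, $\omega$, $\omega_i^\alpha$. For $a$, with $\nabla a^{i\beta\gamma}_{\alpha jk}=da^{i\beta\gamma}_{\alpha jk}-a^{i\beta\gamma}_{\delta jk}\omega_\alpha^\delta-a^{i\beta\gamma}_{\alpha lk}\omega_j^l-a^{i\beta\gamma}_{\alpha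 jl}\omega_k^l+a^{l\beta\gamma}_{\alpha jk}\omega_l^i+a^{i\delta\gamma}_{\alpha jk}\omega_\delta^\beta+a^{i\beta\delta}_{\alpha jk}\omega_\delta^\gamma$, one has $\nabla a^{i\beta\gamma}_{\alpha jk}+a^{i\beta\gamma}_{\alpha jk}\,\omega=a^{i\beta\gamma\delta}_{\alpha jkl}\,\omega_\delta^l$, and the $a^{i\beta\gamma\delta}_{\alpha jkl}$ are the Pfaffian derivatives. *)

(* Defs.v *)
From HB Require Import structures.
From mathcomp Require Import all_boot all_order all_algebra.
From mathcomp Require Import all_classical all_reals all_analysis.

Set Implicit Arguments.
Unset Strict Implicit.
Unset Printing Implicit Defensive.

Import Order.TTheory GRing.Theory Num.Theory.
Import numFieldNormedType.Exports.
Local Open Scope classical_set_scope.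
Local Open Scope ring_scope.

Section SmoothFunctions.
Variable R : realType.

Fixpoint Ck (n k : nat) (U : set 'rV[R]_n) (f : 'rV[R]_n -> R) : Prop :=
  (forall x, U x -> {for x, continuous f}) /\
  match k with
  | 0%N => True
  | k'.+1 => forall i : 'I_n,
      (forall x, U x -> derivable f x (delta_mx 0 i)) /\
      Ck k' U (fun x => 'D_(delta_mx 0 i) f x)
  end.

Definition smooth_on (n : nat) (U : set 'rV[R]_n) (f : 'rV[R]_n -> R) :=
  forall k, Ck k U f.

Definition smooth_vec_on (n m : nat) (U : set 'rV[R]_n)
    (f : 'rV[R]_n -> 'rV[R]_m) :=
  forall j, smooth_on U (fun x => f x 0 j).

End SmoothFunctions.

(* [chart_map] and [chart_inv] are total functions that are meaningful only on
   [chart_dom] and on its image. *)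
Record chart (R : realType) (n : nat) (M : topologicalType) := Chart {
  chart_dom : set M;
  chart_map : M -> 'rV[R]_n;
  chart_inv : 'rV[R]_n -> M;
  open_chart_dom : open chart_dom;
  open_chart_img : open (chart_map @` chart_dom);
  chart_mapK : forall x, chart_dom x -> chart_inv (chart_map x) = x;
  chart_map_continuous : forall x, chart_dom x -> {for x, continuous chart_map};
  chart_inv_continuous : forall y, (chart_map @` chart_dom) y ->
    {for y, continuous chart_inv}
}.

Definition chart_img (R : realType) n (M : topologicalType) (c : chart R n M) :
  set 'rV[R]_n := chart_map c @` chart_dom c.

(* Every point x has a preferred chart [chart_at x].  The tangent space at x is
   identified with R^n through that chart: tangent vectors are rows, covectors
   are columns, and the pairing is the matrix product. *)
Record manifold (R : realType) (n : nat) := Manifold {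
  carrier :> topologicalType;
  manifold_hausdorff : hausdorff_space carrier;
  manifold_second_countable : @second_countable carrier;
  atlas : set (chart R n carrier);
  chart_at : carrier -> chart R n carrier;
  atlas_chart_at : forall x, atlas (chart_at x);
  dom_chart_at : forall x, chart_dom (chart_at x) x;
  atlas_compatible : forall c d, atlas c -> atlas d ->
    smooth_vec_on [set y | chart_img c y /\ chart_dom d (chart_inv c y)]
      (fun y => chart_map d (chart_inv c y))
}.

Section Calculus.
Variable R : realType.

Definition smooth_fun n (M : manifold R n) (f : M -> R) :=
  forall c, atlas c -> smooth_on (chart_img c) (fun y => f (chart_inv c y)).

Definition smooth_map_on n m (M : manifold R n) (N : manifold R m)
    (U : set M) (f : M -> N) :=
  (forall x, U x -> {for x, continuous f}) /\
  forall c d, atlas c -> atlas d ->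
    smooth_vec_on
      [set y | [/\ chart_img c y, U (chart_inv c y) &
         chart_dom d (f (chart_inv c y))]]
      (fun y => chart_map d (f (chart_inv c y))).

(* Joint smoothness on U x F of a map M x F -> P. *)
Definition smooth_map2_on n m k (M : manifold R n) (F : manifold R m)
    (P : manifold R k) (U : set M) (s : M -> F -> P) :=
  (forall x z, U x -> {for (x, z), continuous (fun w : M * F => s w.1 w.2)}) /\
  forall c d e, atlas c -> atlas d -> atlas e ->
    smooth_vec_on
      [set w : 'rV[R]_(n + m) |
         [/\ chart_img c (lsubmx w), chart_img d (rsubmx w),
         U (chart_inv c (lsubmx w)) &
         chart_dom e (s (chart_inv c (lsubmx w)) (chart_inv d (rsubmx w)))]]
      (fun w => chart_map e
                  (s (chart_inv c (lsubmx w)) (chart_inv d (rsubmx w)))).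

Definition locally_trivial n m k (P : manifold R k) (M : manifold R n)
    (pi : P -> M) :=
  exists F : manifold R m, forall x : M, exists U : set M,
    [/\ open U, U x &
     exists (t : P -> F) (s : M -> F -> P),
       [/\ smooth_map_on (pi @^-1` U) t, smooth_map2_on U s,
           (forall y z, U y -> pi (s y z) = y /\ t (s y z) = z) &
           (forall u, U (pi u) -> s (pi u) (t u) = u)]].

(* The tangent vector v at x is sent to [v *m dmap f x]. *)
Definition dmap n m (M : manifold R n) (N : manifold R m) (f : M -> N) (x : M)
  : 'M[R]_(n, m) :=
  jacobian (fun y => chart_map (chart_at (f x)) (f (chart_inv (chart_at x) y)))
    (chart_map (chart_at x) x).

Definition dfun n (M : manifold R n) (f : M -> R) (x : M) : 'cV[R]_n :=
  \col_i 'D_(delta_mx 0 i) (fun y => f (chart_inv (chart_at x) y))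
           (chart_map (chart_at x) x).

(* Coordinate expression, in the chart c, of a field of tangent vectors. *)
Definition local_vect n (M : manifold R n) (c : chart R n M)
    (v : M -> 'rV[R]_n) (y : 'rV[R]_n) : 'rV[R]_n :=
  let x := chart_inv c y in
  v x *m jacobian (fun z => chart_map c (chart_inv (chart_at x) z))
           (chart_map (chart_at x) x).

Definition smooth_vect_on n (M : manifold R n) (U : set M)
    (v : M -> 'rV[R]_n) :=
  forall c, atlas c ->
    smooth_vec_on [set y | chart_img c y /\ U (chart_inv c y)] (local_vect c v).

Definition form1 n (M : manifold R n) := M -> 'cV[R]_n.

(* Pull-back of the 1-form w to coordinates by the inverse of the chart c. *)
Definition local_form n (M : manifold R n) (c : chart R n M) (w : form1 M)
    (y : 'rV[R]_n) : 'cV[R]_n :=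
  let x := chart_inv c y in
  jacobian (fun z => chart_map (chart_at x) (chart_inv c z)) y *m w x.

Definition smooth_form n (M : manifold R n) (w : form1 M) :=
  forall c, atlas c -> forall i : 'I_n,
    smooth_on (chart_img c) (fun y => local_form c w y i 0).

(* Coordinate 2-forms are skew matrices W, with value u *m W *m v^T on (u, v).
   An equality of 2-forms on a manifold is an equality in every chart. *)
Definition ext_deriv n (M : manifold R n) (c : chart R n M) (y : 'rV[R]_n)
    (w : form1 M) : 'M[R]_n :=
  \matrix_(i, j) ('D_(delta_mx 0 i) (fun z => local_form c w z j 0) y
                  - 'D_(delta_mx 0 j) (fun z => local_form c w z i 0) y).

Definition wedge n (M : manifold R n) (c : chart R n M) (y : 'rV[R]_n)
    (w1 w2 : form1 M) : 'M[R]_n :=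
  local_form c w1 y *m (local_form c w2 y)^T
  - local_form c w2 y *m (local_form c w1 y)^T.

End Calculus.

Section AlmostGrassmann.
Variables (R : realType) (p q : nat).

(* A frame e_i^alpha of a tangent space is [e i alpha]. *)
Definition frame := 'I_q -> 'I_p -> 'rV[R]_(p * q).

Definition frame_comb (e : frame) (z : 'M[R]_(p, q)) : 'rV[R]_(p * q) :=
  \sum_(al < p) \sum_(i < q) z al i *: e i al.

Definition is_frame (e : frame) :=
  forall v, exists! z : 'M[R]_(p, q), v = frame_comb e z.

Definition segre_cone (e : frame) : set 'rV[R]_(p * q) :=
  [set v | exists (t : 'I_p -> R) (s : 'I_q -> R),
     v = frame_comb e (\matrix_(al, i) (t al * s i))].

Definition adapted (C : set 'rV[R]_(p * q)) (e : frame) :=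
  is_frame e /\ C = segre_cone e.

Record AG_structure (M : manifold R (p * q)) := AGStructure {
  SC : M -> set 'rV[R]_(p * q);
  SC_smooth : forall x : M, exists (U : set M) (e : M -> frame),
    [/\ open U, U x,
        (forall i al, smooth_vect_on U (fun y => e y i al)) &
        (forall y, U y -> adapted (SC y) (e y))]
}.

(* 'e_i^alpha = A^alpha_beta A_i^j e_j^beta *)
Definition change_frame (A : 'M[R]_p) (B : 'M[R]_q) (e : frame) : frame :=
  fun i al => \sum_(be < p) \sum_(j < q) (A al be * B i j) *: e j be.

Definition bundle_dim := (2 * (p * q) + p ^ 2 + q ^ 2 - 1)%N.
Definition fibre_dim := (p * q + p ^ 2 + q ^ 2 - 1)%N.

(* Indices are listed in reading order: lower then upper for the forms,
   upper then lower for the structure functions. *)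
Record structure_data (P : manifold R bundle_dim) := StructureData {
  om : 'I_p -> 'I_q -> form1 P;     (* [om al i]   : omega_alpha^i *)
  omp : 'I_p -> 'I_p -> form1 P;    (* [omp al be] : omega_alpha^beta *)
  omq : 'I_q -> 'I_q -> form1 P;    (* [omq j i]   : omega_j^i *)
  om0 : form1 P;                    (* omega *)
  omd : 'I_q -> 'I_p -> form1 P;    (* [omd i al]  : omega_i^alpha *)
  (* [ta u i be ga al j k] : a^{i beta gamma}_{alpha j k} *)
  ta : P -> 'I_q -> 'I_p -> 'I_p -> 'I_p -> 'I_q -> 'I_q -> R;
  (* [tb1 u i ga de j k l] : b^{i gamma delta}_{j k l} *)
  tb1 : P -> 'I_q -> 'I_p -> 'I_p -> 'I_q -> 'I_q -> 'I_q -> R;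
  (* [tb2 u be ga de al k l] : b^{beta gamma delta}_{alpha k l} *)
  tb2 : P -> 'I_p -> 'I_p -> 'I_p -> 'I_p -> 'I_q -> 'I_q -> R;
  (* [tc u al be ga i j k] : c^{alpha beta gamma}_{i j k} *)
  tc : P -> 'I_p -> 'I_p -> 'I_p -> 'I_q -> 'I_q -> 'I_q -> R
}.

Section Equations.
Variables (P : manifold R bundle_dim) (D : structure_data P).

Definition smooth_data : Prop :=
  [/\ [/\ forall al i, smooth_form (om D al i),
          forall al be, smooth_form (omp D al be),
          forall j i, smooth_form (omq D j i),
          smooth_form (om0 D) &
          forall i al, smooth_form (omd D i al)],
      forall i be ga al j k, smooth_fun (fun u => ta D u i be ga al j k),
      forall i ga de j k l, smooth_fun (fun u => tb1 D u i ga de j k l),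
      forall be ga de al k l, smooth_fun (fun u => tb2 D u be ga de al k l) &
      forall al be ga i j k, smooth_fun (fun u => tc D u al be ga i j k)].

Definition lin_comb (u : P) (x : 'I_p -> 'I_q -> R) (y : 'I_p -> 'I_p -> R)
    (z : 'I_q -> 'I_q -> R) (w : R) (v : 'I_q -> 'I_p -> R)
  : 'cV[R]_bundle_dim :=
  \sum_(al < p) \sum_(i < q) x al i *: om D al i u
  + \sum_(al < p) \sum_(be < p) y al be *: omp D al be u
  + \sum_(j < q) \sum_(i < q) z j i *: omq D j i u
  + w *: om0 D u
  + \sum_(i < q) \sum_(al < p) v i al *: omd D i al u.

Definition trace_conditions (u : P) : Prop :=
  \sum_(ga < p) omp D ga ga u = 0 /\ \sum_(k < q) omq D k k u = 0.

Definition spanning (u : P) : Prop :=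
  forall t, exists x y z w v, t = lin_comb u x y z w v.

(* The only linear relations are consequences of the two trace conditions. *)
Definition independent (u : P) : Prop :=
  forall x y z w v, lin_comb u x y z w v = 0 ->
    [/\ forall al i, x al i = 0,
        exists r : R, forall al be, y al be = r *+ (al == be),
        exists r : R, forall j i, z j i = r *+ (j == i),
        w = 0 &
        forall i al, v i al = 0].

(* The Pfaffian derivatives of f at u are the coefficients [f' de l] of the
   forms omega_delta^l in the expansion of df. *)
Definition pfaffian (u : P) (f : P -> R) (f' : 'I_p -> 'I_q -> R) : Prop :=
  exists y z w v, dfun f u = lin_comb u f' y z w v.

Section AtPoint.
Variables (c : chart R bundle_dim P) (y : 'rV[R]_bundle_dim).
Let u : P := chart_inv c y.
Local Notation d := (ext_deriv c y).
Local Notation "f ∧ g" := (wedge c y f g) (at level 40, left associativity).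
Local Notation a := (ta D u).
Local Notation b1 := (tb1 D u).
Local Notation b2 := (tb2 D u).
Local Notation cc := (tc D u).
Local Notation om := (om D).
Local Notation omp := (omp D).
Local Notation omq := (omq D).
Local Notation om0 := (om0 D).
Local Notation omd := (omd D).

Definition eq_om : Prop := forall (al : 'I_p) (i : 'I_q),
  d (om al i) - \sum_j om al j ∧ omq j i - \sum_be omp al be ∧ om be i
    - om0 ∧ om al i
  = \sum_be \sum_j \sum_ga \sum_k a i be ga al j k *: (om be j ∧ om ga k).

Definition eq_omp : Prop := forall al be : 'I_p,
  d (omp al be) - \sum_ga omp al ga ∧ omp ga be
  = (q%:R / (p + q)%:R) *:
      ((\sum_ga \sum_k om ga k ∧ omd k ga) *+ (al == be)
       - p%:R *: \sum_k om al k ∧ omd k be)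
    + \sum_ga \sum_k \sum_de \sum_l
        b2 be ga de al k l *: (om ga k ∧ om de l).

Definition eq_omq : Prop := forall j i : 'I_q,
  d (omq j i) - \sum_k omq j k ∧ omq k i
  = (p%:R / (p + q)%:R) *:
      ((\sum_k \sum_ga omd k ga ∧ om ga k) *+ (j == i)
       - q%:R *: \sum_ga omd j ga ∧ om ga i)
    + \sum_ga \sum_k \sum_de \sum_l
        b1 i ga de j k l *: (om ga k ∧ om de l).

Definition eq_om0 : Prop := d om0 = \sum_i \sum_al omd i al ∧ om al i.

Definition eq_omd : Prop := forall (i : 'I_q) (al : 'I_p),
  d (omd i al) - \sum_be omd i be ∧ omp be al - \sum_j omq i j ∧ omd j al
    + om0 ∧ omd i al
  = \sum_be \sum_j \sum_ga \sum_k cc al be ga i j k *: (om ga k ∧ om be j)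
    - \sum_k \sum_ga \sum_be \sum_j
        a k al be ga i j *: (omd k ga ∧ om be j).

End AtPoint.

Definition structure_equations : Prop :=
  forall c, atlas c -> forall y, chart_img c y ->
    [/\ eq_om c y, eq_omp c y, eq_omq c y, eq_om0 c y & eq_omd c y].

Definition a_conditions (u : P) : Prop :=
  let a := ta D u in
  [/\ forall i be ga al j k, a i be ga al j k = - a i ga be al k j,
      forall i ga j k, \sum_al a i al ga al j k = 0 &
      forall be ga al k, \sum_i a i be ga al i k = 0].

Definition b_conditions (u : P) : Prop :=
  let b1 := tb1 D u in let b2 := tb2 D u in
  [/\ forall be ga de al k l, b2 be ga de al k l = - b2 be de ga al l k,
      forall i ga de j k l, b1 i ga de j k l = - b1 i de ga j l k,
      forall ga de k l, \sum_al b2 al ga de al k l = 0,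
      forall ga de k l, \sum_i b1 i ga de i k l = 0 &
      forall ga de k l,
        \sum_al b2 ga al de al k l - \sum_i b1 i ga de k i l
        + \sum_al b2 de al ga al l k - \sum_i b1 i de ga l i k = 0].

Definition c_conditions (u : P) : Prop :=
  let c := tc D u in
  (forall al be ga i j k, c al be ga i j k = - c al ga be i k j) /\
  (forall al be ga i j k,
     c al be ga i j k + c be ga al j k i + c ga al be k i j
     - c al ga be i k j - c ga be al k j i - c be al ga j i k = 0).

End Equations.

(* Each u in P determines an adapted frame [fr u] at [proj u], and the forms
   omega_alpha^i are the coefficients of d proj in this frame. *)
Record frame_bundle (M : manifold R (p * q)) (S : AG_structure M) :=
  FrameBundle {
  bundle : manifold R bundle_dim;
  proj : bundle -> M;
  proj_smooth : smooth_map_on setT proj;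
  proj_surj : forall x, exists u, proj u = x;
  proj_bundle : locally_trivial fibre_dim proj;
  fr : bundle -> frame;
  fr_adapted : forall u, adapted (SC S (proj u)) (fr u);
  fr_orbit : forall u (e : frame),
    (exists2 u', proj u' = proj u & fr u' = e) <->
    (exists A B, [/\ A \in unitmx, B \in unitmx &
                     e = change_frame A B (fr u)]);
  frame_data :> structure_data bundle;
  data_smooth : smooth_data frame_data;
  fr_om : forall u (v : 'rV[R]_bundle_dim),
    v *m dmap proj u
    = frame_comb (fr u) (\matrix_(al, i) (v *m om frame_data al i u) 0 0);
  data_trace : forall u, trace_conditions frame_data u;
  data_spanning : forall u, spanning frame_data u;
  data_independent : forall u, independent frame_data u;
  data_equations : structure_equations frame_data;
  data_a : forall u, a_conditions frame_data u;
  data_b : forall u, b_conditions frame_data u;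
  data_c : forall u, c_conditions frame_data u
}.

End AlmostGrassmann.

Inductive torsion_var (p q : nat) : Type :=
  | Va (i : 'I_q) (be ga al : 'I_p) (j k : 'I_q)
  | Vda (i : 'I_q) (be ga de al : 'I_p) (j k l : 'I_q).

(* A universal formula is a polynomial expression with rational coefficients. *)
Inductive formula (V : Type) : Type :=
  | Fconst of rat
  | Fvar of V
  | Fadd of formula V & formula V
  | Fmul of formula V & formula V.

Fixpoint eval_formula (R : realType) (V : Type) (rho : V -> R)
    (F : formula V) : R :=
  match F with
  | Fconst r => ratr r
  | Fvar v => rho v
  | Fadd F1 F2 => eval_formula rho F1 + eval_formula rho F2
  | Fmul F1 F2 => eval_formula rho F1 * eval_formula rho F2
  end.

(* [a] and [a'] hold the values of a^{i beta gamma}_{alpha j k} and of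
   a^{i beta gamma delta}_{alpha j k l} at a point. *)
Definition torsion_env (R : realType) (p q : nat)
    (a : 'I_q -> 'I_p -> 'I_p -> 'I_p -> 'I_q -> 'I_q -> R)
    (a' : 'I_q -> 'I_p -> 'I_p -> 'I_p -> 'I_p -> 'I_q -> 'I_q -> 'I_q -> R)
    (v : torsion_var p q) : R :=
  match v with
  | Va i be ga al j k => a i be ga al j k
  | Vda i be ga de al j k l => a' i be ga de al j k l
  end.

(* Main.v *)
Require Import Defs.
From mathcomp Require Import all_boot all_order all_algebra.
From mathcomp Require Import all_classical all_reals all_analysis.
From mathcomp Require Import ring lra.

Set Implicit Arguments.
Unset Strict Implicit.
Unset Printing Implicit Defensive.

Import Order.TTheory GRing.Theory Num.Theory.
Import numFieldNormedType.Exports.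
Local Open Scope classical_set_scope.
Local Open Scope ring_scope.

(** Differentiating the structure equation of omega_alpha^i once more kills its
left-hand side, since d d = 0.  Evaluate the resulting 3-form on three tangent
vectors of the bundle on which every basis form other than the omega_alpha^i
vanishes.  There the exterior derivatives of the fibre forms reduce to the
curvature terms b1 and b2 (all products with a fibre form drop out), d omega
reduces to 0 and d omega_alpha^i to the torsion term, so one gets a first
Bianchi identity ([first_bianchi]): the cyclic sum over three index pairs
(beta_1, j_1), (beta_2, j_2), (beta_3, j_3) of

  b^{beta_3 beta_1 beta_2}_{alpha j_1 j_2} delta^i_{j_3}
    - b^{i beta_1 beta_2}_{j_3 j_1 j_2} delta_alpha^{beta_3}

is a polynomial in a and its Pfaffian derivatives.

It remains to see that this linear system, together with the normalization of
b1 and b2, determines both.  Call a quantity expressible if some fixed formula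
computes it for all structures; expressible quantities are closed under ring
operations and division by positive integers, so one may solve linear
equations without writing the formulas down.

Contracting i with j_3 gives, for fixed alpha, j_1, j_2 and in terms of
g(a, b, c) = b^{c a b}_{alpha j_1 j_2}, the combination
q g(a, b, c) - g(c, b, a) - g(a, c, b) up to contractions of b1.  The sum of two
distinct transpositions in the group algebra of S_3 has eigenvalues among
2, 1, -1, -2, so for q > 2 this operator is invertible
([expressible_swap3]) and b2 follows from the contractions.  The case p > 2 and
the contraction of alpha with beta_3 give b1 in the same way.

For the contractions P = [contr2] and Q = [contr1], one further trace of the
identity gives the part of P - Q that is skew under exchanging both index
pairs, the normalization says that the symmetric part vanishes, and another
trace gives (p + q) P minus two index exchanges of P, which is invertible since
p + q > 2 ([expressible_swap2]). *)

(** * Symmetry of mixed partial derivatives *)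

Section MixedPartials.
Variables (R : realType) (n : nat).
Implicit Types (f : 'rV[R]_n -> R) (u v y : 'rV[R]_n).

Lemma is_derive_line f y u (t : R) : derivable f (y + t *: u) u ->
  is_derive t 1 (fun s : R => f (y + s *: u)) ('D_u f (y + t *: u)).
Proof.
move=> df.
have E : (fun h : R => h^-1 *: (f (y + (h *: 1 + t) *: u) - f (y + t *: u)))
       = (fun h : R => h^-1 *: (f (h *: u + (y + t *: u)) - f (y + t *: u))).
  apply/funext => h; congr (_ *: (f _ - _)).
  by rewrite -[h *: 1]/(h * 1) mulr1 scalerDl addrCA.
apply: DeriveDef; rewrite /derivable /derive /= E //.
Qed.

Lemma mvt_line f y u (h : R) : 0 < h ->
  (forall t, 0 <= t <= h -> derivable f (y + t *: u) u) ->
  exists2 t, 0 <= t <= h & f (y + h *: u) - f y = h * 'D_u f (y + t *: u).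
Proof.
move=> h0 df.
have D t : 0 <= t <= h -> is_derive t 1 (fun s : R => f (y + s *: u))
                            ('D_u f (y + t *: u)).
  by move=> /df /is_derive_line.
have [|||t] := @MVT R (fun s => f (y + s *: u))
                 (fun t => 'D_u f (y + t *: u)) 0 h => //.
- by move=> t; rewrite in_itv /= => /andP[/ltW t0 /ltW th]; apply: D; rewrite t0.
- apply: derivable_within_continuous => t; rewrite in_itv /= => th.
  by have [] := D _ th.
- rewrite in_itv /= => /andP[/ltW t0 /ltW th]; rewrite scale0r addr0 subr0 => E.
  by exists t; rewrite ?t0 // E mulrC.
Qed.

(** The mean value theorem along u applied to x |-> f (x + h v) - f x, and then
along v applied to the derivative of f along u.  Applied with u and v exchanged
it writes the same second difference with the other mixed derivative. *)
Lemma second_difference f y u v (h : R) : 0 < h ->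
  (forall s t, 0 <= s <= h -> 0 <= t <= h ->
     derivable f (y + s *: u + t *: v) u /\
     derivable ('D_u f) (y + s *: u + t *: v) v) ->
  exists s t, [/\ 0 <= s <= h, 0 <= t <= h &
    f (y + h *: u + h *: v) - f (y + h *: u) - f (y + h *: v) + f y
    = h * (h * 'D_v ('D_u f) (y + s *: u + t *: v))].
Proof.
move=> h0 df; have hh : 0 <= h <= h by rewrite (ltW h0) /=.
have h00 : 0 <= (0 : R) <= h by rewrite (ltW h0) lexx.
pose g x := f (x + h *: v) - f x.
have shift x : derivable f (x + h *: v) u ->
    is_derive x u (fun z => f (z + h *: v)) ('D_u f (x + h *: v)).
  have E : (fun k : R => k^-1 *: (f (k *: u + x + h *: v) - f (x + h *: v)))
         = (fun k : R => k^-1 *: (f (k *: u + (x + h *: v)) - f (x + h *: v))).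
    by apply/funext => k; rewrite addrA.
  by move=> d; apply: DeriveDef; rewrite /derivable /derive /= E.
have dg s : 0 <= s <= h -> is_derive (y + s *: u) u g
    ('D_u f (y + s *: u + h *: v) - 'D_u f (y + s *: u)).
  move=> sh; have d1 := shift _ (df s h sh hh).1.
  have d2 : is_derive (y + s *: u) u f ('D_u f (y + s *: u)).
    by apply: derivableP; case: (df s 0 sh h00); rewrite scale0r addr0.
  exact: is_deriveB.
have [s sh E1] := @mvt_line g y u h h0
  (fun s sh => @ex_derive _ _ _ _ _ _ _ (dg s sh)).
have [t th E2] : exists2 t, 0 <= t <= h &
    'D_u f (y + s *: u + h *: v) - 'D_u f (y + s *: u)
    = h * 'D_v ('D_u f) (y + s *: u + t *: v).
  by apply: (@mvt_line ('D_u f) (y + s *: u) v) => // t th; case: (df s t sh th).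
exists s, t; split => //; rewrite -E2.
have := dg s sh => /@derive_val <-; rewrite -E1 /g; ring.
Qed.

Lemma eq_of_meet_near (A B : 'rV[R]_n -> R) y :
  {for y, continuous A} -> {for y, continuous B} ->
  (forall r, 0 < r -> exists x x', [/\ ball y r x, ball y r x' & A x = B x']) ->
  A y = B y.
Proof.
move=> cA cB meet; apply/eqP; rewrite -subr_eq0 -normr_le0.
apply/ler_addgt0Pr => e e0; rewrite add0r.
have e2 : 0 < e / 2 by rewrite divr_gt0.
have /nbhs_ballP [r1 /= r10 n1] : \forall x \near nbhs y, `|A y - A x| < e / 2.
  exact: (cvgr_dist_lt _ _ cA).
have /nbhs_ballP [r2 /= r20 n2] : \forall x \near nbhs y, `|B y - B x| < e / 2.
  exact: (cvgr_dist_lt _ _ cB).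
have [|x [x' [yx yx' E]]] := meet (Num.min r1 r2); first by rewrite lt_min r10.
have dA : `|A y - A x| < e / 2.
  by apply: n1; apply: le_ball yx; rewrite ge_min lexx.
have dB : `|B y - B x'| < e / 2.
  by apply: n2; apply: le_ball yx'; rewrite ge_min lexx orbT.
rewrite E in dA.
have := ler_normD (A y - B x') (B x' - B y).
rewrite subrKA [`|B x' - B y|]distrC; lra.
Qed.

(** Only directional derivatives are assumed to exist, in place of Frechet
differentiability: this is what iterating the partial derivatives provides. *)
Lemma schwarz f (U : set 'rV[R]_n) y u v : open U -> U y ->
  (forall x, U x -> derivable f x u /\ derivable f x v) ->
  (forall x, U x -> derivable ('D_u f) x v /\ derivable ('D_v f) x u) ->
  {for y, continuous ('D_v ('D_u f))} -> {for y, continuous ('D_u ('D_v f))} ->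
  'D_v ('D_u f) y = 'D_u ('D_v f) y.
Proof.
move=> oU Uy d1 d2 c1 c2; apply: (eq_of_meet_near c1 c2) => r1 r10.
have /nbhs_ballP [r2 /= r20 n2] : nbhs y U by exact: open_nbhs_nbhs.
pose r := Num.min r1 r2; have r0 : 0 < r by rewrite lt_min r10 r20.
(* The sides of the parallelogram are scaled to stay in the ball of radius r. *)
pose k := `|u| + `|v| + 1.
have k0 : 0 < k by rewrite ltr_wpDl // addr_ge0.
pose h := r / k; have h0 : 0 < h by rewrite divr_gt0.
have inball s t : 0 <= s <= h -> 0 <= t <= h -> ball y r (y + s *: u + t *: v).
  move=> /andP[s0 sh] /andP[t0 th]; rewrite -ball_normE /ball_ /=.
  rewrite -addrA opprD addNKr normrN (le_lt_trans (ler_normD _ _)) // !normrZ.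
  rewrite !ger0_norm //.
  have -> : r = h * k by rewrite /h divfK // gt_eqF.
  have : s * `|u| <= h * `|u| by rewrite ler_wpM2r.
  have : t * `|v| <= h * `|v| by rewrite ler_wpM2r.
  rewrite /k; nra.
have inU s t : 0 <= s <= h -> 0 <= t <= h -> U (y + s *: u + t *: v).
  move=> sh th; apply: n2; apply: le_ball (inball s t sh th).
  by rewrite ge_min lexx orbT.
have inr1 s t : 0 <= s <= h -> 0 <= t <= h -> ball y r1 (y + s *: u + t *: v).
  by move=> sh th; apply: le_ball (inball s t sh th); rewrite ge_min lexx.
have [|s1 [t1 [s1h t1h E1]]] := @second_difference f y u v h h0.
  move=> s t sh th; have Ux := inU _ _ sh th.
  exact: (conj (d1 _ Ux).1 (d2 _ Ux).1).
have [|t2 [s2 [t2h s2h E2]]] := @second_difference f y v u h h0.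
  move=> t s th sh; have Ux := inU _ _ sh th.
  rewrite addrAC; exact: (conj (d1 _ Ux).2 (d2 _ Ux).2).
exists (y + s1 *: u + t1 *: v), (y + t2 *: v + s2 *: u); split.
- exact: inr1.
- rewrite addrAC; exact: inr1.
have hn0 := lt0r_neq0 h0.
move: E1 E2; rewrite (addrAC y (h *: v)).
move: ('D_v ('D_u f) (y + s1 *: u + t1 *: v)) => A.
move: ('D_u ('D_v f) (y + t2 *: v + s2 *: u)) => A'.
move: (f (y + h *: u + h *: v)) (f (y + h *: u)) (f (y + h *: v)) (f y).
move=> f1 f2 f3 f4 E1 E2.
suff: h * (h * A) = h * (h * A') by move=> /(mulfI hn0)/(mulfI hn0).
by rewrite -E1 -E2; ring.
Qed.
End MixedPartials.

(** * Exterior calculus in a chart *)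

Section FormalDerivative.
Variables (R : realType) (n : nat).
Implicit Types (g h : 'rV[R]_n -> R) (u v y : 'rV[R]_n).

(** The derivative along a constant vector v is the combination of the partial
derivatives with the coordinates of v, so that the product rule needs the
existence of partial derivatives only. *)
Definition pder y v g (r : R) :=
  exists d : 'I_n -> R, (forall i, is_derive y (delta_mx 0 i) g (d i)) /\
    r = \sum_i v 0 i * d i.

Lemma pder_unique y v g r s : pder y v g r -> pder y v g s -> r = s.
Proof.
move=> [d [dg ->]] [e [eg ->]]; apply: eq_bigr => i _; congr (_ * _).
by rewrite -(@derive_val _ _ _ _ _ _ _ (dg i)) -(@derive_val _ _ _ _ _ _ _ (eg i)).
Qed.

Lemma pder_near y v g h r : (\near y, g y = h y) -> pder y v g r -> pder y v h r.
Proof.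
move=> gh [d [dg ->]]; exists d; split=> // i.
exact: near_eq_is_derive gh (dg i).
Qed.

Lemma pder_cst y v (a : R) : pder y v (fun=> a) 0.
Proof.
exists (fun=> 0); split=> [i|]; first exact: is_derive_cst.
by rewrite big1 // => i _; rewrite mulr0.
Qed.

Lemma pderD y v g h r s : pder y v g r -> pder y v h s ->
  pder y v (fun z => g z + h z) (r + s).
Proof.
move=> [d [dg ->]] [e [eh ->]]; exists (fun i => d i + e i); split=> [i|].
  exact: is_deriveD (dg i) (eh i).
by rewrite -big_split; apply: eq_bigr => i _; rewrite mulrDr.
Qed.

Lemma pderM y v g h r s : pder y v g r -> pder y v h s ->
  pder y v (fun z => g z * h z) (r * h y + g y * s).
Proof.
move=> [d [dg ->]] [e [eh ->]].
exists (fun i => g y *: e i + h y *: d i); split=> [i|].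
  exact: is_deriveM (dg i) (eh i).
rewrite mulr_suml mulr_sumr -big_split; apply: eq_bigr => i _.
by rewrite /= -![_ *: _]/(_ * _); ring.
Qed.

Lemma pderB y v g h r s : pder y v g r -> pder y v h s ->
  pder y v (fun z => g z - h z) (r - s).
Proof.
move=> [d [dg ->]] [e [eh ->]]; exists (fun i => d i - e i); split=> [i|].
  exact: is_deriveB (dg i) (eh i).
by rewrite -sumrB; apply: eq_bigr => i _; rewrite mulrBr.
Qed.

Lemma pder_sum y v (I : finType) (g : I -> 'rV[R]_n -> R) (r : I -> R) :
  (forall i, pder y v (g i) (r i)) ->
  pder y v (fun z => \sum_i g i z) (\sum_i r i).
Proof.
move=> gr; elim: (index_enum I) => [|i s IH].
  under eq_fun do rewrite big_nil.
  rewrite big_nil; exact: pder_cst.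
under eq_fun do rewrite big_cons.
rewrite big_cons; exact: pderD.
Qed.

(** For constant vector fields all brackets vanish, so the exterior derivative of
a 2-form W is the cyclic sum of the derivatives of its values. *)
Definition dform2 y v1 v2 v3 (W : 'rV[R]_n -> 'rV[R]_n -> 'rV[R]_n -> R) (r : R) :=
  exists r1 r2 r3, [/\ pder y v1 (W v2 v3) r1, pder y v2 (W v3 v1) r2,
    pder y v3 (W v1 v2) r3 & r = r1 + r2 + r3].

Section ExteriorDerivative.
Variables y v1 v2 v3 : 'rV[R]_n.
Local Notation dform2 := (dform2 y v1 v2 v3).

Lemma dform2_unique W r s : dform2 W r -> dform2 W s -> r = s.
Proof.
move=> [r1 [r2 [r3 [h1 h2 h3 ->]]]] [s1 [s2 [s3 [k1 k2 k3 ->]]]].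
by rewrite (pder_unique h1 k1) (pder_unique h2 k2) (pder_unique h3 k3).
Qed.

Lemma dform2_near W W' r : (\near y, forall v v', W v v' y = W' v v' y) ->
  dform2 W r -> dform2 W' r.
Proof.
move=> E [r1 [r2 [r3 [h1 h2 h3 ->]]]]; exists r1, r2, r3; split=> //.
- by apply: pder_near h1; apply: filterS E.
- by apply: pder_near h2; apply: filterS E.
- by apply: pder_near h3; apply: filterS E.
Qed.

Lemma dform2D W W' r s : dform2 W r -> dform2 W' s ->
  dform2 (fun v v' z => W v v' z + W' v v' z) (r + s).
Proof.
move=> [r1 [r2 [r3 [h1 h2 h3 ->]]]] [s1 [s2 [s3 [k1 k2 k3 ->]]]].
exists (r1 + s1), (r2 + s2), (r3 + s3); split; [exact: pderD..|ring].
Qed.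

Lemma dform2_sum (I : finType) (W : I -> _) r : (forall i, dform2 (W i) (r i)) ->
  dform2 (fun v v' z => \sum_i W i v v' z) (\sum_i r i).
Proof.
move=> Wr; have /choice[r1 h1] := Wr; have /choice[r2 h2] := h1.
have /choice[r3 h3] := h2.
exists (\sum_i r1 i), (\sum_i r2 i), (\sum_i r3 i); split.
- by apply: pder_sum => i; case: (h3 i).
- by apply: pder_sum => i; case: (h3 i).
- by apply: pder_sum => i; case: (h3 i).
by rewrite -!big_split; apply: eq_bigr => i _; case: (h3 i).
Qed.

Lemma dform2M a a1 a2 a3 W r :
  pder y v1 a a1 -> pder y v2 a a2 -> pder y v3 a a3 -> dform2 W r ->
  dform2 (fun v v' z => a z * W v v' z)
     (a1 * W v2 v3 y + a2 * W v3 v1 y + a3 * W v1 v2 y + a y * r).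
Proof.
move=> da1 da2 da3 [r1 [r2 [r3 [h1 h2 h3 ->]]]].
exists (a1 * W v2 v3 y + a y * r1), (a2 * W v3 v1 y + a y * r2),
  (a3 * W v1 v2 y + a y * r3); split; [exact: pderM..|ring].
Qed.

End ExteriorDerivative.

Section Forms.
Implicit Types f w : 'rV[R]_n -> 'cV[R]_n.

Definition pairing w v z : R := (v *m w z) 0 0.

Definition curl w z : 'M[R]_n :=
  \matrix_(i, j) ('D_(delta_mx 0 i) (fun t => w t j 0) z
                  - 'D_(delta_mx 0 j) (fun t => w t i 0) z).

(** The value on (v, v') of the 2-form with skew matrix W. *)
Definition bil v v' (W : 'M[R]_n) : R := (v *m W *m v'^T) 0 0.

Lemma bilZ v v' a W : bil v v' (a *: W) = a * bil v v' W.
Proof. by rewrite /bil -scalemxAr -scalemxAl mxE. Qed.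

Lemma bilD v v' W W' : bil v v' (W + W') = bil v v' W + bil v v' W'.
Proof. by rewrite /bil mulmxDr mulmxDl mxE. Qed.

Lemma bilN v v' W : bil v v' (- W) = - bil v v' W.
Proof. by rewrite -scaleN1r bilZ mulN1r. Qed.

Lemma bilMn v v' W m : bil v v' (W *+ m) = bil v v' W *+ m.
Proof. by rewrite -scaler_nat bilZ mulr_natl. Qed.

Lemma bil_sum v v' (I : finType) (W : I -> 'M[R]_n) :
  bil v v' (\sum_i W i) = \sum_i bil v v' (W i).
Proof. by rewrite /bil mulmx_sumr mulmx_suml summxE. Qed.

Lemma bilE v v' W : bil v v' W = \sum_i \sum_j v 0 i * v' 0 j * W i j.
Proof.
rewrite /bil !mxE exchange_big; apply: eq_bigr => j _.
by rewrite !mxE mulr_suml; apply: eq_bigr => i _; rewrite mulrAC.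
Qed.

Lemma bil_wedge v v' (f g : 'cV[R]_n) :
  bil v v' (f *m g^T - g *m f^T)
  = (v *m f) 0 0 * (v' *m g) 0 0 - (v *m g) 0 0 * (v' *m f) 0 0.
Proof.
have E (f1 f2 : 'cV[R]_n) :
    bil v v' (f1 *m f2^T) = (v *m f1) 0 0 * (v' *m f2) 0 0.
  rewrite bilE !mxE big_distrlr; apply: eq_bigr => i _; apply: eq_bigr => j _.
  by rewrite /= !mxE big_ord1 !mxE mulrACA.
by rewrite bilD bilN !E.
Qed.

Definition diff_form y w :=
  forall i k, derivable (fun z => w z k 0) y (delta_mx 0 i).

Definition jac w y v v' : R :=
  \sum_i v 0 i * \sum_k v' 0 k * 'D_(delta_mx 0 i) (fun z => w z k 0) y.

Lemma pder_pairing y w v v' : diff_form y w -> pder y v (pairing w v') (jac w y v v').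
Proof.
move=> dw; exists (fun i => \sum_k v' 0 k * 'D_(delta_mx 0 i) (fun z => w z k 0) y).
split=> // i.
have -> : pairing w v' = \sum_k (v' 0 k \*o (fun z => w z k 0)).
  by apply/funext => z; rewrite /pairing mxE fct_sumE.
apply: is_derive_sum => k.
by rewrite -deriveMl //; apply/derivableP/derivableM.
Qed.

Lemma bil_curl y w v v' : bil v v' (curl w y) = jac w y v v' - jac w y v' v.
Proof.
rewrite bilE /jac.
under [X in _ = X - _]eq_bigr do rewrite mulr_sumr.
under [X in _ = _ - X]eq_bigr do rewrite mulr_sumr.
rewrite [X in _ = _ - X]exchange_big -sumrB; apply: eq_bigr => i _.
by rewrite -sumrB; apply: eq_bigr => k _; rewrite mxE; ring.
Qed.

Definition wedge2 f (g : 'rV[R]_n -> 'cV[R]_n) v v' z : R :=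
  pairing f v z * pairing g v' z - pairing g v z * pairing f v' z.

(** d (f ∧ g) = df ∧ g - f ∧ dg. *)
Lemma dform2_wedge y v1 v2 v3 f (g : 'rV[R]_n -> 'cV[R]_n) :
  diff_form y f -> diff_form y g ->
  dform2 y v1 v2 v3 (wedge2 f g)
    (bil v1 v2 (curl f y) * pairing g v3 y - pairing f v1 y * bil v2 v3 (curl g y)
     + (bil v2 v3 (curl f y) * pairing g v1 y - pairing f v2 y * bil v3 v1 (curl g y))
     + (bil v3 v1 (curl f y) * pairing g v2 y - pairing f v3 y * bil v1 v2 (curl g y))).
Proof.
move=> df dg.
have W a b b' := pderB (pderM (pder_pairing a b df) (pder_pairing a b' dg))
                       (pderM (pder_pairing a b dg) (pder_pairing a b' df)).
do 3!eexists; split; [exact: W..|rewrite !bil_curl].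
by move: (jac f y) (jac g y) (pairing f ^~ y) (pairing g ^~ y) => F G f0 g0; ring.
Qed.

(** This is d d w = 0: the six second derivatives cancel in pairs. *)
Lemma dform2_curl (U : set 'rV[R]_n) y v1 v2 v3 w : open U -> U y ->
  (forall k, smooth_on U (fun z => w z k 0)) ->
  dform2 y v1 v2 v3 (fun v v' z => bil v v' (curl w z)) 0.
Proof.
move=> oU Uy sw.
pose D i k := 'D_(delta_mx 0 i) (fun z => w z k 0).
pose H i j k := 'D_(delta_mx 0 i) (D j k) y.
have d1 k i x : U x -> derivable (fun z => w z k 0) x (delta_mx 0 i).
  by move=> Ux; have [_ /(_ i) [dk _]] := sw k 1%N; exact: dk.
have d2 k i j x : U x -> derivable (D i k) x (delta_mx 0 j).
  move=> Ux; have [_ /(_ i) [_ C]] := sw k 2%N.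
  by case: C => _ /(_ j) [dk _]; exact: dk.
have c2 k i j x : U x -> {for x, continuous ('D_(delta_mx 0 j) (D i k))}.
  move=> Ux; have [_ /(_ i) [_ C]] := sw k 2%N.
  by case: C => _ /(_ j) [_ [ck _]]; exact: ck.
have Hsym i j k : H i j k = H j i k.
  apply: (@schwarz R n (fun z => w z k 0) U) => //.
  - by move=> x Ux; split; exact: d1.
  - by move=> x Ux; split; exact: d2.
  - exact: c2.
  - exact: c2.
pose S (a b e : 'rV[R]_n) := \sum_i \sum_j \sum_k a 0 i * b 0 j * e 0 k * H i j k.
have Ssym a b e : S a b e = S b a e.
  rewrite /S exchange_big; apply: eq_bigr => i _; apply: eq_bigr => j _.
  by apply: eq_bigr => k _; rewrite Hsym (mulrC (a 0 j)).
have P a b e : pder y a (fun z => bil b e (curl w z)) (S a b e - S a e b).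
  have E i : is_derive y (delta_mx 0 i) (fun z => bil b e (curl w z))
      (\sum_j \sum_k b 0 j * e 0 k * (H i j k - H i k j)).
    have -> : (fun z => bil b e (curl w z)) =
      \sum_j \sum_k ((b 0 j * e 0 k) \*o (D j k - D k j)).
      apply/funext => z; rewrite bilE fct_sumE; apply: eq_bigr => j _.
      by rewrite fct_sumE; apply: eq_bigr => k _; rewrite mxE.
    apply: is_derive_sum => j; apply: is_derive_sum => k.
    have dB : is_derive y (delta_mx 0 i) (D j k - D k j) (H i j k - H i k j).
      by apply: is_deriveB; apply/derivableP/d2.
    rewrite -[H i j k - _](@derive_val _ _ _ _ _ _ _ dB).
    rewrite -deriveMl; last by case: dB.
    by apply/derivableP/derivableM => //; case: dB.
  exists (fun i => \sum_j \sum_k b 0 j * e 0 k * (H i j k - H i k j)).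
  split=> //; rewrite /S -sumrB; apply: eq_bigr => i _.
  rewrite [X in _ - X]exchange_big -sumrB mulr_sumr; apply: eq_bigr => j _.
  rewrite -sumrB mulr_sumr; apply: eq_bigr => k _.
  by move: (H i j k) (H i k j) => h1 h2; ring.
do 3!eexists; split; [exact: P..|].
rewrite (Ssym v2 v1) (Ssym v3 v2) (Ssym v3 v1); ring.
Qed.

End Forms.
End FormalDerivative.

(** * Universal formulas *)

Section Expressible.
Variables (R : realType) (V T : Type) (env : T -> V -> R).

(** T is the type of all instances at once: the formula must not depend on t. *)
Definition expressible (X : T -> R) :=
  exists F : formula V, forall t, X t = eval_formula (env t) F.

Lemma expressible_ext X Y : X =1 Y -> expressible X -> expressible Y.
Proof. by move=> E [F FE]; exists F => t; rewrite -E. Qed.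

Lemma expressible_var v : expressible (fun t => env t v).
Proof. by exists (Fvar v). Qed.

Lemma expressible_rat (r : rat) : expressible (fun=> ratr r).
Proof. by exists (Fconst V r). Qed.

Lemma expressible_nat n : expressible (fun=> n%:R).
Proof.
by apply: expressible_ext (expressible_rat n%:R) => t; rewrite ratr_nat.
Qed.

Lemma expressibleD X Y : expressible X -> expressible Y ->
  expressible (fun t => X t + Y t).
Proof. by move=> [F FE] [G GE]; exists (Fadd F G) => t /=; rewrite FE GE. Qed.

Lemma expressibleM X Y : expressible X -> expressible Y ->
  expressible (fun t => X t * Y t).
Proof. by move=> [F FE] [G GE]; exists (Fmul F G) => t /=; rewrite FE GE. Qed.

Lemma expressibleN X : expressible X -> expressible (fun t => - X t).
Proof.
move=> eX; apply: expressible_ext (expressibleM (expressible_rat (-1)) eX) => t.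
by rewrite rmorphN1 mulN1r.
Qed.

Lemma expressibleB X Y : expressible X -> expressible Y ->
  expressible (fun t => X t - Y t).
Proof. by move=> eX eY; apply: expressibleD => //; apply: expressibleN. Qed.

Lemma expressible_sum (I : finType) (X : I -> T -> R) :
  (forall i, expressible (X i)) -> expressible (fun t => \sum_i X i t).
Proof.
move=> eX; elim: (index_enum I) => [|i s IH].
  by apply: expressible_ext (expressible_nat 0) => t; rewrite big_nil.
by apply: expressible_ext (expressibleD (eX i) IH) => t; rewrite big_cons.
Qed.

Lemma expressible_divn n X : (0 < n)%N ->
  expressible (fun t => n%:R * X t) -> expressible X.
Proof.
move=> n0 eX.
apply: expressible_ext (expressibleM (expressible_rat n%:R^-1) eX) => t.
by rewrite /= fmorphV rmorph_nat mulKf // pnatr_eq0 -lt0n.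
Qed.

(** The determinant of the system is n ^ 2 - 1. *)
Lemma expressible_pair n X Y : (1 < n)%N ->
  expressible (fun t => n%:R * X t - Y t) ->
  expressible (fun t => n%:R * Y t - X t) -> expressible X.
Proof.
move=> n1 eX eY; apply: (@expressible_divn (n * n - 1)).
  by rewrite subn_gt0 (leq_trans n1) // leq_pmulr // ltnW.
apply: expressible_ext
  (expressibleD (expressibleM (expressible_nat n) eX) eY) => t.
rewrite natrB ?natrM ?muln_gt0 ?(ltnW n1) //; ring.
Qed.

(** The two exchanges commute and square to 1, so n minus their sum has the
eigenvalues n - 2, n and n + 2: first invert on the part symmetric in the first
pair, then on the whole space. *)
Lemma expressible_swap2 (I J : Type) n (f : I -> I -> J -> J -> T -> R) :
  (2 < n)%N ->
  (forall a b k l,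
     expressible (fun t => n%:R * f a b k l t - f b a k l t - f a b l k t)) ->
  forall a b k l, expressible (f a b k l).
Proof.
case: n => [|n] // n2 ef a b k l.
have esym k' l' : expressible (fun t => f a b k' l' t + f b a k' l' t).
  have e k1 l1 : expressible (fun t => n%:R * (f a b k1 l1 t + f b a k1 l1 t)
                                      - (f a b l1 k1 t + f b a l1 k1 t)).
    apply: expressible_ext (expressibleD (ef a b k1 l1) (ef b a k1 l1)) => t.
    by rewrite -natr1; ring.
  exact: expressible_pair (e k' l') (e l' k').
have e k1 l1 : expressible (fun t => n.+2%:R * f a b k1 l1 t - f a b l1 k1 t).
  apply: expressible_ext (expressibleD (ef a b k1 l1) (esym k1 l1)) => t.
  by rewrite -!natr1; ring.
exact: expressible_pair (e k l) (e l k).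
Qed.

(** Let A be the sum of the exchanges of a, c and of b, c.  Then (n - A) f is
expressible, hence so is (n + A) (n - A) f = (n ^ 2 - A ^ 2) f, and
A ^ 2 = 2 + r + r ^ 2 for the rotation r.  Summing over rotations gives
(n ^ 2 - 4) (1 + r + r ^ 2) f; adding (1 + r + r ^ 2) f back to
(n ^ 2 - A ^ 2) f leaves (n ^ 2 - 1) f.  For n = 2 the division by n ^ 2 - 4
fails. *)
Lemma expressible_swap3 (I : Type) n (f : I -> I -> I -> T -> R) : (2 < n)%N ->
  (forall a b c,
     expressible (fun t => n%:R * f a b c t - f c b a t - f a c b t)) ->
  forall a b c, expressible (f a b c).
Proof.
move=> n2 ef a b c.
have en := expressible_nat n.
have n24 : (4 < n * n)%N by rewrite (leq_trans _ (leq_mul n2 n2)).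
have esq a' b' c' : expressible
    (fun t => (n%:R * n%:R - 2) * f a' b' c' t - f b' c' a' t - f c' a' b' t).
  have := expressibleD (expressibleM en (ef a' b' c'))
            (expressibleD (ef c' b' a') (ef a' c' b')).
  apply: expressible_ext => t; ring.
have erot : expressible (fun t => f a b c t + f b c a t + f c a b t).
  apply: (@expressible_divn (n * n - 4)); first by rewrite subn_gt0.
  have := expressibleD (esq a b c) (expressibleD (esq b c a) (esq c a b)).
  by apply: expressible_ext => t; rewrite natrB ?(ltnW n24) // natrM; ring.
apply: (@expressible_divn (n * n - 1)); first by rewrite subn_gt0 (ltn_trans _ n24).
have := expressibleD (esq a b c) erot.
apply: expressible_ext => t; rewrite natrB ?natrM; first by ring.
by rewrite (leq_trans _ n24).
Qed.

End Expressible.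

(** * The linear system for the curvature *)

Section Bianchi.
Variables (R : realType) (p q : nat).
Implicit Types x y : 'M[R]_(p, q).

(** The 2-form with coefficients f in the products omega_be^j ∧ omega_ga^k, on
vectors whose omega-coordinates are x and y. *)
Definition form2 (f : 'I_p -> 'I_q -> 'I_p -> 'I_q -> R) x y : R :=
  \sum_be \sum_j \sum_ga \sum_k
    f be j ga k * (x be j * y ga k - x ga k * y be j).

Definition cyclic (f : 'M[R]_(p, q) -> 'M[R]_(p, q) -> 'M[R]_(p, q) -> R)
    x1 x2 x3 : R := f x1 x2 x3 + f x2 x3 x1 + f x3 x1 x2.

Definition torsion2 (a : 'I_q -> 'I_p -> 'I_p -> 'I_p -> 'I_q -> 'I_q -> R)
    al i x y : R := form2 (fun be j ga k => a i be ga al j k) x y.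

(** On vectors killed by the fibre forms, its cyclic sum is the exterior
derivative of the torsion term a^{i be ga}_{al j k} omega_be^j ∧ omega_ga^k: the
first line comes from da, the second from d omega_be^j and d omega_ga^k. *)
Definition torsion_part
    (a : 'I_q -> 'I_p -> 'I_p -> 'I_p -> 'I_q -> 'I_q -> R)
    (a' : 'I_q -> 'I_p -> 'I_p -> 'I_p -> 'I_p -> 'I_q -> 'I_q -> 'I_q -> R)
    al i x1 x2 x3 : R :=
  \sum_be \sum_j \sum_ga \sum_k
    ((\sum_de \sum_l a' i be ga de al j k l * x1 de l)
       * (x2 be j * x3 ga k - x2 ga k * x3 be j)
     + a i be ga al j k
       * (torsion2 a be j x1 x2 * x3 ga k - x1 be j * torsion2 a ga k x2 x3)).

(** The data of a structure at one point of its frame bundle that determine b1 and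
b2 there.  Formulas valid on the whole of this type are universal, because it
forgets the manifold. *)
Record torsion_jet := TorsionJet {
  ja : 'I_q -> 'I_p -> 'I_p -> 'I_p -> 'I_q -> 'I_q -> R;
  ja' : 'I_q -> 'I_p -> 'I_p -> 'I_p -> 'I_p -> 'I_q -> 'I_q -> 'I_q -> R;
  jb1 : 'I_q -> 'I_p -> 'I_p -> 'I_q -> 'I_q -> 'I_q -> R;
  jb2 : 'I_p -> 'I_p -> 'I_p -> 'I_p -> 'I_q -> 'I_q -> R;
  jb2_skew : forall be ga de al k l, jb2 be ga de al k l = - jb2 be de ga al l k;
  jb1_skew : forall i ga de j k l, jb1 i ga de j k l = - jb1 i de ga j l k;
  jb2_trace : forall ga de k l, \sum_al jb2 al ga de al k l = 0;
  jb1_trace : forall ga de k l, \sum_i jb1 i ga de i k l = 0;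
  jb_normal : forall ga de k l,
    \sum_al jb2 ga al de al k l - \sum_i jb1 i ga de k i l
    + \sum_al jb2 de al ga al l k - \sum_i jb1 i de ga l i k = 0;
  jbianchi : forall al i x1 x2 x3,
    cyclic (fun x y z =>
      \sum_be form2 (fun ga k de l => jb2 be ga de al k l) x y * z be i
      - \sum_j x al j * form2 (fun ga k de l => jb1 i ga de j k l) y z) x1 x2 x3
    + cyclic (torsion_part ja ja' al i) x1 x2 x3 = 0
}.

Lemma sum_delta_mx (F : 'I_p -> 'I_q -> R) be j :
  \sum_ga \sum_k F ga k * (delta_mx be j : 'M[R]_(p, q)) ga k = F be j.
Proof.
rewrite (bigD1 be) //= (bigD1 j) //= !mxE !eqxx mulr1 !big1 ?addr0 //.
  move=> ga /negPf nga; rewrite big1 // => k _.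
  by rewrite mxE nga mulr0.
by move=> k /negPf nk; rewrite mxE nk andbF mulr0.
Qed.

Lemma form2_delta f be j ga k :
  form2 f (delta_mx be j) (delta_mx ga k) = f be j ga k - f ga k be j.
Proof.
rewrite /form2.
under eq_bigr do under eq_bigr do under eq_bigr do under eq_bigr
  do rewrite mulrBr !mulrA.
under eq_bigr do under eq_bigr do under eq_bigr do rewrite sumrB.
under eq_bigr do under eq_bigr do rewrite sumrB.
under eq_bigr do rewrite sumrB.
rewrite sumrB; congr (_ - _).
  under eq_bigr do under eq_bigr do rewrite sum_delta_mx.
  by rewrite sum_delta_mx.
rewrite -(sum_delta_mx (fun b l => f b l be j)); apply: eq_bigr => b _.
apply: eq_bigr => l _.
rewrite -(sum_delta_mx (fun c m => f b l c m)) mulr_suml.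
by apply: eq_bigr => c _; rewrite mulr_suml.
Qed.

Definition jenv (t : torsion_jet) := torsion_env (ja t) (ja' t).

Local Notation expr := (expressible jenv).

Lemma expressible_delta be j ga k :
  expr (fun=> (delta_mx be j : 'M[R]_(p, q)) ga k).
Proof.
by apply: expressible_ext (expressible_nat _ _) => t; rewrite mxE.
Qed.

Lemma expressible_torsion2 al i be j ga k :
  expr (fun t => torsion2 (ja t) al i (delta_mx be j) (delta_mx ga k)).
Proof.
apply: (@expressible_ext _ _ _ _
  (fun t => ja t i be ga al j k - ja t i ga be al k j)).
  by move=> t; rewrite /torsion2 form2_delta.
apply: expressibleB.
  exact: (expressible_var jenv (Va i be ga al j k)).
exact: (expressible_var jenv (Va i ga be al k j)).
Qed.

Lemma expressible_torsion_part al i b1 j1 b2 j2 b3 j3 :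
  expr (fun t => torsion_part (ja t) (ja' t) al i
                   (delta_mx b1 j1) (delta_mx b2 j2) (delta_mx b3 j3)).
Proof.
have ed := expressible_delta; have et := expressible_torsion2.
do 4!apply: expressible_sum => ?.
apply: expressibleD; apply: expressibleM.
- do 2!apply: expressible_sum => ?; apply: expressibleM => //.
  exact: (expressible_var jenv (Vda _ _ _ _ _ _ _ _)).
- by apply: expressibleB; apply: expressibleM.
- exact: (expressible_var jenv (Va _ _ _ _ _ _)).
- by apply: expressibleB; apply: expressibleM.
Qed.

(** The identity on basis vectors; b1 and b2 appear twice because a 2-form
counts each pair of arguments in both orders. *)
Lemma expressible_bianchi al i b1 j1 b2 j2 b3 j3 :
  expr (fun t =>
    jb2 t b3 b1 b2 al j1 j2 * (i == j3)%:R
    + jb2 t b1 b2 b3 al j2 j3 * (i == j1)%:R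
    + jb2 t b2 b3 b1 al j3 j1 * (i == j2)%:R
    - (al == b3)%:R * jb1 t i b1 b2 j3 j1 j2
    - (al == b1)%:R * jb1 t i b2 b3 j1 j2 j3
    - (al == b2)%:R * jb1 t i b3 b1 j2 j3 j1).
Proof.
apply: (@expressible_divn _ _ _ _ 2) => //.
have := expressibleN (expressibleD (expressibleD
  (expressible_torsion_part al i b1 j1 b2 j2 b3 j3)
  (expressible_torsion_part al i b2 j2 b3 j3 b1 j1))
  (expressible_torsion_part al i b3 j3 b1 j1 b2 j2)).
apply: expressible_ext => t.
have /eqP := jbianchi t al i (delta_mx b1 j1) (delta_mx b2 j2) (delta_mx b3 j3).
rewrite addr_eq0 => /eqP E; rewrite -[LHS]E /cyclic => {E}.
have C2 be j ga k c l :
    \sum_be0 form2 (fun ga0 k0 de l0 => jb2 t be0 ga0 de al k0 l0)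
      (delta_mx be j) (delta_mx ga k) * (delta_mx c l : 'M[R]_(p, q)) be0 i
    = 2 * (jb2 t c be ga al j k * (i == l)%:R).
  rewrite (bigD1 c) //= big1 ?addr0 => [|c' /negPf nc].
    rewrite form2_delta mxE eqxx /= [X in _ - X]jb2_skew; ring.
  by rewrite mxE nc mulr0.
have C1 be j ga k c l :
    \sum_j0 (delta_mx c l : 'M[R]_(p, q)) al j0 *
      form2 (fun ga0 k0 de l0 => jb1 t i ga0 de j0 k0 l0)
      (delta_mx be j) (delta_mx ga k)
    = 2 * ((al == c)%:R * jb1 t i be ga l j k).
  rewrite (bigD1 l) //= big1 ?addr0 => [|l' /negPf nl].
    rewrite form2_delta mxE eqxx andbT /= [X in _ - X]jb1_skew; ring.
  by rewrite mxE nl andbF mul0r.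
rewrite !C1 !C2; ring.
Qed.

Definition contr2 (t : torsion_jet) ga de k l := \sum_al jb2 t ga al de al k l.
Definition contr1 (t : torsion_jet) ga de k l := \sum_i jb1 t i ga de k i l.

Lemma sum_pick (I : finType) (F : I -> R) a : \sum_i F i * (i == a)%:R = F a.
Proof.
rewrite (bigD1 a) //= eqxx mulr1 big1 ?addr0 // => i /negPf ->.
by rewrite mulr0.
Qed.

Lemma sum_pickl (I : finType) (F : I -> R) a : \sum_i (i == a)%:R * F i = F a.
Proof. by rewrite -[RHS]sum_pick; apply: eq_bigr => i _; rewrite mulrC. Qed.

(** The contraction of i with j_3.  The trace of b1 on its own upper index
vanishes, and the two other terms in b1 become contractions. *)
Lemma expressible_trace_latin al a b c k l :
  expr (fun t => q%:R * jb2 t c a b al k l - jb2 t a c b al k l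
                 - jb2 t b a c al k l
                 + (al == a)%:R * contr1 t c b k l
                 - (al == b)%:R * contr1 t c a l k).
Proof.
have := expressible_sum (fun i => expressible_bianchi al i a k b l c i).
apply: expressible_ext => t.
rewrite !sumrB !big_split /=.
under eq_bigr do rewrite eqxx mulr1.
rewrite sumr_const card_ord -mulr_natl.
rewrite !sum_pick -!mulr_sumr jb1_trace mulr0 subr0.
rewrite [jb2 t a b c al l k]jb2_skew [jb2 t b c a al l k]jb2_skew.
have -> : \sum_i jb1 t i b c k l i = - contr1 t c b k l.
  by rewrite -sumrN; apply: eq_bigr => i _; rewrite jb1_skew.
rewrite -/(contr1 t c a l k); ring.
Qed.

(** The contraction of alpha with beta_3, which exchanges the roles of p and q. *)
Lemma expressible_trace_greek i a b k l m :
  expr (fun t => - contr2 t a b m l * (i == k)%:R + contr2 t b a m k * (i == l)%:R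
    - (p%:R * jb1 t i a b m k l - jb1 t i a b k m l - jb1 t i a b l k m)).
Proof.
have := expressible_sum (fun al => expressible_bianchi al i a k b l al m).
apply: expressible_ext => t.
rewrite !sumrB !big_split /=.
rewrite -!mulr_suml jb2_trace mul0r add0r.
under [X in X * jb1 _ _ _ _ _ _ _]eq_bigr do rewrite eqxx mulr1n.
rewrite sumr_const card_ord !sum_pickl.
rewrite [jb1 t i b a k l m]jb1_skew [jb1 t i b a l m k]jb1_skew.
have -> : \sum_al jb2 t a b al al l m = - contr2 t a b m l.
  by rewrite -sumrN; apply: eq_bigr => be _; rewrite jb2_skew.
rewrite -/(contr2 t b a m k); ring.
Qed.

(** Write P for [contr2] and Q for [contr1].  Tracing alpha with c in
[expressible_trace_latin] gives P - Q minus its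
exchange in both index pairs; the normalization of b1 and b2 says that the
exchange is the opposite of P - Q. *)
Lemma expressible_contr_diff a b k l :
  expr (fun t => contr2 t a b k l - contr1 t a b k l).
Proof.
apply: (@expressible_divn _ _ _ _ 2) => //.
have := expressibleN (expressible_sum (fun al => expressible_trace_latin al a b al k l)).
apply: expressible_ext => t.
rewrite !big_split /= !sumrN -!mulr_sumr jb2_trace mulr0 sub0r !sum_pickl.
have -> : \sum_al jb2 t b a al al k l = - contr2 t b a l k.
  by rewrite -sumrN; apply: eq_bigr => be _; rewrite jb2_skew.
have := jb_normal t a b k l.
rewrite -/(contr2 t a b k l) -/(contr1 t a b k l).
rewrite -/(contr2 t b a l k) -/(contr1 t b a l k).
lra.
Qed.

(** With the same P and Q, tracing alpha with a gives
q P(c, b, k, l) - P(b, c, k, l) + p Q(c, b, k, l) - Q(c, b, l, k), where Q may be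
replaced by P since P - Q is expressible. *)
Lemma expressible_contr2 c b k l : (2 < p)%N -> expr (fun t => contr2 t c b k l).
Proof.
move=> p2.
apply: (@expressible_swap2 _ _ _ _ _ _ (p + q)
  (fun c b k l t => contr2 t c b k l)) => [|{}c {}b {}k {}l].
  exact: leq_trans p2 (leq_addr _ _).
have := expressible_sum (fun al => expressible_trace_latin al al b c k l).
move=> /expressibleD/(_ (expressibleM (expressible_nat _ p)
          (expressible_contr_diff c b k l))).
move=> /expressibleB/(_ (expressible_contr_diff c b l k)).
apply: expressible_ext => t.
rewrite !big_split /= !sumrN -!mulr_sumr jb2_trace !sum_pickl subr0.
under eq_bigr do rewrite eqxx mul1r.
rewrite sumr_const card_ord -mulr_natl natrD -!/(contr2 _ _ _ _ _); ring.
Qed.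

Lemma expressible_contr1 c b k l : (2 < p)%N -> expr (fun t => contr1 t c b k l).
Proof.
move=> p2; have := expressibleB (expressible_contr2 c b k l p2)
                     (expressible_contr_diff c b k l).
by apply: expressible_ext => t; ring.
Qed.

Lemma expressible_jb2 be ga de al k l : (2 < p)%N -> (2 < q)%N ->
  expr (fun t => jb2 t be ga de al k l).
Proof.
move=> p2 q2.
apply: (@expressible_swap3 _ _ _ _ _ _ (fun a b c t => jb2 t c a b al k l) q2).
move=> a b c.
have := expressibleB (expressible_trace_latin al a b c k l)
  (expressibleB
     (expressibleM (expressible_nat _ (al == a)) (expressible_contr1 c b k l p2))
     (expressibleM (expressible_nat _ (al == b)) (expressible_contr1 c a l k p2))).
by apply: expressible_ext => t; ring.
Qed.

Lemma expressible_jb1 i ga de j k l : (2 < p)%N ->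
  expr (fun t => jb1 t i ga de j k l).
Proof.
move=> p2.
apply: (@expressible_swap3 _ _ _ _ _ _ (fun k l j t => jb1 t i ga de j k l) p2).
move=> {}k {}l m.
have := expressibleB
  (expressibleD
     (expressibleM (expressibleN (expressible_contr2 ga de m l p2))
        (expressible_nat _ (i == k)))
     (expressibleM (expressible_contr2 de ga m k p2) (expressible_nat _ (i == l))))
  (expressible_trace_greek i ga de k l m).
by apply: expressible_ext => t; ring.
Qed.

End Bianchi.

(** * Tangent vectors dual to the coframe *)

Section DualVectors.
Variables (R : fieldType) (n : nat).

(** Independence of phi i0 from the others is all that is assumed: the other
phi i may be dependent, as the trace conditions impose on the fibre forms.  The
vector is a column of the cokernel of the others, rescaled. *)
Lemma dual_vector (I : finType) (phi : I -> 'cV[R]_n) (i0 : I) :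
  (forall c : I -> R, \sum_i c i *: phi i = 0 -> c i0 = 0) ->
  exists v : 'rV[R]_n, forall i, (v *m phi i) 0 0 = (i == i0)%:R.
Proof.
move=> ind; pose F i := if i == i0 then 0 else (phi i)^T.
pose A := \matrix_(k < #|I|) F (enum_val k).
have rowA i : row (enum_rank i) A = F i by rewrite rowK enum_rankK.
have n0 : ~~ ((phi i0)^T <= A)%MS.
  apply/negP => /submxP [C E].
  pose c i := if i == i0 then 1 else - C 0 (enum_rank i).
  suff /ind : \sum_i c i *: phi i = 0.
    by rewrite /c eqxx => /eqP; rewrite oner_eq0.
  have : phi i0 = \sum_i C 0 (enum_rank i) *: (F i)^T.
    apply: trmx_inj; rewrite {}E mulmx_sum_row linear_sum /=.
    rewrite (reindex (@enum_rank I)) /=; last exact: onW_bij (enum_rank_bij I).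
    by apply: eq_bigr => k _; rewrite linearZ /= trmxK rowA.
  rewrite (bigD1 i0) //= {1}/F eqxx trmx0 scaler0 add0r => E'.
  rewrite (bigD1 i0) //= {1}/c eqxx scale1r {1}E' -big_split big1 //= => i ni.
  by rewrite /c /F (negPf ni) trmxK scaleNr subrr.
have : (phi i0)^T *m cokermx A != 0 by rewrite -submxE.
case/rV0Pn => j nj; pose w := col j (cokermx A).
have Aw : A *m w = 0 by rewrite /w colE mulmxA mulmx_coker mul0mx.
pose r := ((phi i0)^T *m w) 0 0.
have r0 : r != 0 by rewrite /r /w colE mulmxA -colE mxE.
exists (r^-1 *: w^T) => i.
have E : (r^-1 *: w^T *m phi i) 0 0 = r^-1 * ((phi i)^T *m w) 0 0.
  by rewrite -scalemxAl mxE -[in LHS](trmxK (phi i)) -trmx_mul mxE.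
rewrite {}E; case: eqVneq => [->|ni]; first by rewrite -/r mulVf.
have -> : (phi i)^T = row (enum_rank i) A by rewrite rowA /F (negPf ni).
by rewrite -row_mul Aw row0 mxE mulr0.
Qed.

End DualVectors.

Lemma chart_img_inv (R : realType) n (M : topologicalType) (c : chart R n M) z :
  chart_img c z -> chart_map c (chart_inv c z) = z.
Proof. by move=> [x cx <-]; rewrite chart_mapK. Qed.

(** The tangent space at u is defined by the chart [chart_at u], so reading a form
in that chart at u involves the transition from the chart to itself. *)
Lemma local_form_chart_at (R : realType) n (M : manifold R n) (u : M) (w : form1 M) :
  local_form (chart_at u) w (chart_map (chart_at u) u) = w u.
Proof.
rewrite /local_form chart_mapK; last exact: dom_chart_at.
set c := chart_at u; set y := chart_map c u.
have Uy : chart_img c y by exists u => //; exact: dom_chart_at.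
have N : \near y, chart_map c (chart_inv c y) = y.
  have /= := open_nbhs_nbhs (conj (@open_chart_img _ _ _ c) Uy).
  by apply: filterS => z /chart_img_inv.
have -> : 'J (fun z => chart_map c (chart_inv c z)) y = 1%:M.
  apply/row_matrixP => i; rewrite !rowE mulmx1 mul_rV_lin1.
  rewrite (@diff_unique _ _ _ _ idfun) //.
    by move=> x; exact: cvg_id.
  apply/eqaddoP => e e0.
  have N0 : \forall h \near (0 : 'rV[R]_n), chart_map c (chart_inv c (h + y)) = h + y.
    by move: N; rewrite (near_shift 0 y) subr0.
  apply: filterS N0 => h Eh.
  rewrite !fctE /= Eh (chart_img_inv Uy).
  have -> : h + y - (y + h) = 0 by rewrite [y + h]addrC; exact: subrr.
  by rewrite normr0 mulr_ge0 // ltW.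
by rewrite mul1mx.
Qed.

Section CoframeDual.
Variables (R : realType) (p q : nat) (P : manifold R (bundle_dim p q)).
Variable (D : structure_data P).

Definition coframe_dual (u : P) (x : 'M[R]_(p, q)) (v : 'rV[R]_(bundle_dim p q)) :=
  [/\ forall al i, (v *m om D al i u) 0 0 = x al i,
      forall al be, (v *m omp D al be u) 0 0 = 0,
      forall j i, (v *m omq D j i u) 0 0 = 0,
      (v *m om0 D u) 0 0 = 0 &
      forall i al, (v *m omd D i al u) 0 0 = 0].

Let form_index : Type :=
  ('I_p * 'I_q + ('I_p * 'I_p + ('I_q * 'I_q + (unit + 'I_q * 'I_p))))%type.

Let forms u (s : form_index) : 'cV[R]_(bundle_dim p q) := match s with
  | inl (al, i) => om D al i u
  | inr (inl (al, be)) => omp D al be u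
  | inr (inr (inl (j, i))) => omq D j i u
  | inr (inr (inr (inl _))) => om0 D u
  | inr (inr (inr (inr (i, al)))) => omd D i al u
  end.

Lemma coframe_dual_lin_comb u x v f g h w t : coframe_dual u x v ->
  (v *m lin_comb D u f g h w t) 0 0 = \sum_al \sum_i f al i * x al i.
Proof.
case=> ox px qx hx dx; pose phi (c : 'cV[R]_(bundle_dim p q)) := (v *m c) 0 0.
have phiD c d : phi (c + d) = phi c + phi d by rewrite /phi mulmxDr mxE.
have phiZ a c : phi (a *: c) = a * phi c by rewrite /phi -scalemxAr mxE.
have phi_sum (I : finType) (F : I -> _) : phi (\sum_i F i) = \sum_i phi (F i).
  by rewrite /phi mulmx_sumr summxE.
rewrite -/(phi _) /lin_comb !phiD !phi_sum phiZ [phi (om0 _ _)]hx mulr0 addr0.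
rewrite [X in _ + X + _ + _]big1 => [|al _]; last first.
  by rewrite phi_sum big1 // => be _; rewrite phiZ [phi _]px mulr0.
rewrite [X in _ + X + _]big1 => [|j _]; last first.
  by rewrite phi_sum big1 // => i _; rewrite phiZ [phi _]qx mulr0.
rewrite [X in _ + X]big1 => [|i _]; last first.
  by rewrite phi_sum big1 // => al _; rewrite phiZ [phi _]dx mulr0.
rewrite !addr0; apply: eq_bigr => al _; rewrite phi_sum; apply: eq_bigr => i _.
by rewrite phiZ [phi _]ox.
Qed.

Lemma coframe_dual_delta u be j : independent D u ->
  exists v, coframe_dual u (delta_mx be j) v.
Proof.
move=> ind.
have [c|v Ev] := @dual_vector R _ _ (forms u) (inl (be, j)).
  have E : \sum_i c i *: forms u i = lin_comb D u
      (fun al i => c (inl (al, i))) (fun al be => c (inr (inl (al, be))))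
      (fun j i => c (inr (inr (inl (j, i))))) (c (inr (inr (inr (inl tt)))))
      (fun i al => c (inr (inr (inr (inr (i, al)))))).
    rewrite /lin_comb !big_sumType /= !pair_big_dep /= !addrA.
    have sum_unit (F : unit -> 'cV[R]_(bundle_dim p q)) : \sum_i F i = F tt.
      by rewrite (bigD1 tt) //= big1 ?addr0 // => -[].
    rewrite sum_unit; congr (_ + _ + _ + _ + _); by apply: eq_bigr => -[].
  by rewrite E => /ind [/(_ be j)].
exists v; split=> [al i|al be'|j' i||i al].
- by rewrite [RHS]mxE; exact: (Ev (inl (al, i))).
- exact: (Ev (inr (inl (al, be')))).
- exact: (Ev (inr (inr (inl (j', i))))).
- exact: (Ev (inr (inr (inr (inl tt))))).
- exact: (Ev (inr (inr (inr (inr (i, al)))))).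
Qed.

Lemma coframe_dual_ex u x : independent D u -> exists v, coframe_dual u x v.
Proof.
move=> ind.
have /choice [v Ev] : forall k : 'I_p * 'I_q, exists v,
    coframe_dual u (delta_mx k.1 k.2) v.
  by move=> k; exact: coframe_dual_delta.
exists (\sum_k x k.1 k.2 *: v k).
have E w : ((\sum_k x k.1 k.2 *: v k) *m w) 0 0
         = \sum_k x k.1 k.2 * (v k *m w) 0 0.
  by rewrite mulmx_suml summxE; apply: eq_bigr => k _; rewrite -scalemxAl mxE.
split=> *; rewrite E; try by apply: big1 => k _; case: (Ev k) => *;
  match goal with H : _ |- _ => rewrite H mulr0 end.
rewrite [in RHS](matrix_sum_delta x) pair_big summxE; apply: eq_bigr => k _.
by rewrite [RHS]mxE; case: (Ev k) => ->.
Qed.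

End CoframeDual.

(** * The first Bianchi identity *)

Section FirstBianchi.
Variables (R : realType) (p q : nat) (P : manifold R (bundle_dim p q)).
Variables (D : structure_data P) (u : P).
Variable (a' : 'I_q -> 'I_p -> 'I_p -> 'I_p -> 'I_p -> 'I_q -> 'I_q -> 'I_q -> R).
Hypothesis smoothD : smooth_data D.
Hypothesis eqD : structure_equations D.
Hypothesis indD : independent D u.
Hypothesis derD : forall i be ga al j k,
  pfaffian D u (fun w => ta D w i be ga al j k)
               (fun de l => a' i be ga de al j k l).

Let c := chart_at u.
Let y := chart_map c u.
Let lo (w : form1 P) := local_form c w.

Let atc : atlas c. Proof. exact: atlas_chart_at. Qed.
Let Uy : chart_img c y. Proof. by exists u => //; exact: dom_chart_at. Qed.
Let yu : chart_inv c y = u.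
Proof. by rewrite /y chart_mapK //; exact: dom_chart_at. Qed.

Let pairing_lo w v : pairing (lo w) v y = (v *m w u) 0 0.
Proof. by rewrite /pairing /lo local_form_chart_at. Qed.

Let smooth_diff (w : form1 P) : smooth_form w -> diff_form y (lo w).
Proof. by move=> sw i k; have [_ /(_ i) [d _]] := sw _ atc k 1%N; exact: d. Qed.

Let smooth_closed v1 v2 v3 (w : form1 P) : smooth_form w ->
  dform2 y v1 v2 v3 (fun v v' z => bil v v' (curl (lo w) z)) 0.
Proof.
by move=> sw; apply: dform2_curl (@open_chart_img _ _ _ c) Uy _ => k; exact: sw.
Qed.

Let dual_pairing v x : coframe_dual D u x v ->
  [/\ forall al i, pairing (lo (om D al i)) v y = x al i,
      forall al be, pairing (lo (omp D al be)) v y = 0,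
      forall j i, pairing (lo (omq D j i)) v y = 0 &
      pairing (lo (om0 D)) v y = 0].
Proof. by case=> *; split=> *; rewrite pairing_lo. Qed.

Let bil_wedge_form v v' z (f g : form1 P) :
  bil v v' (wedge c z f g) = wedge2 (lo f) (lo g) v v' z.
Proof. exact: bil_wedge. Qed.

Let curl_om v v' z : chart_img c z -> forall al i,
  bil v v' (curl (lo (om D al i)) z) =
    \sum_j wedge2 (lo (om D al j)) (lo (omq D j i)) v v' z
    + \sum_be wedge2 (lo (omp D al be)) (lo (om D be i)) v v' z
    + wedge2 (lo (om0 D)) (lo (om D al i)) v v' z
    + \sum_be \sum_j \sum_ga \sum_k ta D (chart_inv c z) i be ga al j k
        * wedge2 (lo (om D be j)) (lo (om D ga k)) v v' z.
Proof.
move=> Uz al i; have [/(_ al i) E _ _ _ _] := eqD atc Uz.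
(* From here on the wedge is an atom, not the difference of matrices that it
   denotes. *)
have W := bil_wedge_form v v' z; move: (wedge c z) W E => w W E.
rewrite -[LHS]/(bil v v' (ext_deriv c z (om D al i))).
move/eqP: E; rewrite !subr_eq => /eqP ->; rewrite !bilD !bil_sum W.
under eq_bigr do rewrite bil_sum.
under eq_bigr do under eq_bigr do rewrite bil_sum.
under eq_bigr do under eq_bigr do under eq_bigr do rewrite bil_sum.
under eq_bigr do under eq_bigr do under eq_bigr do under eq_bigr do
  rewrite bilZ W.
under [X in _ + X + _ = _]eq_bigr do rewrite W.
under [X in _ + X = _]eq_bigr do rewrite W.
ring.
Qed.

(* On vectors killed by the fibre forms, every term of the structure equations
   containing a fibre form vanishes. *)
Section AtVectors.
Variables (v v' : 'rV[R]_(bundle_dim p q)) (x x' : 'M[R]_(p, q)).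
Hypotheses (vx : coframe_dual D u x v) (vx' : coframe_dual D u x' v').

Lemma curl_om_at al i :
  bil v v' (curl (lo (om D al i)) y) = torsion2 (ta D u) al i x x'.
Proof.
have [ox px qx hx] := dual_pairing vx; have [ox' px' qx' hx'] := dual_pairing vx'.
rewrite curl_om // yu.
rewrite big1 => [|j _]; last by rewrite /wedge2 qx qx' mul0r mulr0 subrr.
rewrite big1 => [|be _]; last by rewrite /wedge2 px px' mul0r mulr0 subrr.
rewrite /wedge2 hx hx' mul0r mulr0 subrr !add0r.
do 4!apply: eq_bigr => ? _; by rewrite !ox !ox'.
Qed.

Lemma wedge_form2 (b : 'I_p -> 'I_q -> 'I_p -> 'I_q -> R) :
  bil v v' (\sum_ga \sum_k \sum_de \sum_l
     b ga k de l *: wedge c y (om D ga k) (om D de l)) = form2 b x x'.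
Proof.
have [ox _ _ _] := dual_pairing vx; have [ox' _ _ _] := dual_pairing vx'.
do 4!(rewrite bil_sum; apply: eq_bigr => ? _).
by rewrite bilZ bil_wedge_form /wedge2 !ox !ox'.
Qed.

Lemma bil_wedge0 f : (v *m f u) 0 0 = 0 -> (v' *m f u) 0 0 = 0 ->
  forall g, bil v v' (wedge c y f g) = 0 /\ bil v v' (wedge c y g f) = 0.
Proof.
by rewrite -!pairing_lo => f0 f0' g; rewrite !bil_wedge_form /wedge2 f0 f0';
  rewrite !(mul0r, mulr0) subrr.
Qed.

Lemma curl_omp_at al be :
  bil v v' (curl (lo (omp D al be)) y)
  = form2 (fun ga k de l => tb2 D u be ga de al k l) x x'.
Proof.
case: vx vx' => ox px qx hx dx [ox' px' qx' hx' dx'].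
have [_ /(_ al be) E _ _ _] := eqD atc Uy.
have W := wedge_form2; have W0 := bil_wedge0.
rewrite -[LHS]/(bil v v' (ext_deriv c y (omp D al be))).
move: (wedge c y) W W0 E => w W W0 /eqP; rewrite yu subr_eq => /eqP ->.
have scaled r W' : bil v v' ((q%:R / r) *: W') = (q%:R / r) * bil v v' W'.
  exact: bilZ.
have scaledn m W' : bil v v' (m%:R *: W') = m%:R * bil v v' W' by exact: bilZ.
rewrite !bilD W scaled bilD bilN scaledn bilMn !bil_sum.
rewrite big1 => [|k _]; last first.
  rewrite bil_sum big1 // => ga _.
  by case: (W0 _ (dx ga k) (dx' ga k) (om D k ga)).
rewrite big1 => [|k _]; last by case: (W0 _ (dx k be) (dx' k be) (om D al k)).
rewrite big1 => [|ga _]; last by case: (W0 _ (px al ga) (px' al ga) (omp D ga be)).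
by rewrite mul0rn !(mulr0, oppr0, add0r, addr0).
Qed.

Lemma curl_omq_at j i :
  bil v v' (curl (lo (omq D j i)) y)
  = form2 (fun ga k de l => tb1 D u i ga de j k l) x x'.
Proof.
case: vx vx' => ox px qx hx dx [ox' px' qx' hx' dx'].
have [_ _ /(_ j i) E _ _] := eqD atc Uy.
have W := wedge_form2; have W0 := bil_wedge0.
rewrite -[LHS]/(bil v v' (ext_deriv c y (omq D j i))).
move: (wedge c y) W W0 E => w W W0 /eqP; rewrite yu subr_eq => /eqP ->.
have scaled r W' : bil v v' ((p%:R / r) *: W') = (p%:R / r) * bil v v' W'.
  exact: bilZ.
have scaledn m W' : bil v v' (m%:R *: W') = m%:R * bil v v' W' by exact: bilZ.
rewrite !bilD W scaled bilD bilN scaledn bilMn !bil_sum.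
rewrite big1 => [|k _]; last first.
  rewrite bil_sum big1 // => ga _.
  by case: (W0 _ (dx k ga) (dx' k ga) (om D ga k)).
rewrite big1 => [|k _]; last by case: (W0 _ (dx j k) (dx' j k) (om D k i)).
rewrite big1 => [|k _]; last by case: (W0 _ (qx j k) (qx' j k) (omq D k i)).
by rewrite mul0rn !(mulr0, oppr0, add0r, addr0).
Qed.

Lemma curl_om0_at : bil v v' (curl (lo (om0 D)) y) = 0.
Proof.
case: vx vx' => ox px qx hx dx [ox' px' qx' hx' dx'].
have [_ _ _ E _] := eqD atc Uy.
rewrite -[LHS]/(bil v v' (ext_deriv c y (om0 D))).
rewrite E bil_sum big1 // => i _; rewrite bil_sum big1 // => al _.
by case: (bil_wedge0 (dx i al) (dx' i al) (om D al i)).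
Qed.

Lemma pder_ta i be ga al j k :
  pder y v (fun z => ta D (chart_inv c z) i be ga al j k)
           (\sum_de \sum_l a' i be ga de al j k l * x de l).
Proof.
have [_ sa _ _ _] := smoothD.
have [y1 [z1 [w1 [v1 E]]]] := derD i be ga al j k.
exists (fun m => dfun (fun w => ta D w i be ga al j k) u m 0); split=> [m|].
  rewrite mxE; apply: derivableP.
  by have [_ /(_ m) [d _]] := sa i be ga al j k _ atc 1%N; exact: d.
have <- : (v *m dfun (fun w => ta D w i be ga al j k) u) 0 0 =
          \sum_m v 0 m * dfun (fun w => ta D w i be ga al j k) u m 0.
  by rewrite mxE.
by rewrite E (coframe_dual_lin_comb _ _ _ _ _ vx).
Qed.

End AtVectors.

(** Both sides of the structure equation of omega_al^i are differentiated near u: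
the left-hand side is closed, and the right-hand side is expanded by the
Leibniz rule and evaluated on vectors v1, v2, v3 with omega-coordinates
x1, x2, x3. *)
Lemma first_bianchi al i x1 x2 x3 :
  cyclic (fun x y z =>
    \sum_be form2 (fun ga k de l => tb2 D u be ga de al k l) x y * z be i
    - \sum_j x al j * form2 (fun ga k de l => tb1 D u i ga de j k l) y z) x1 x2 x3
  + cyclic (torsion_part (ta D u) a' al i) x1 x2 x3 = 0.
Proof.
have [[so sp sq sh _] sa _ _ _] := smoothD.
have [v1 w1] := coframe_dual_ex x1 indD.
have [v2 w2] := coframe_dual_ex x2 indD.
have [v3 w3] := coframe_dual_ex x3 indD.
have [ox1 px1 qx1 hx1] := dual_pairing w1.
have [ox2 px2 qx2 hx2] := dual_pairing w2.
have [ox3 px3 qx3 hx3] := dual_pairing w3.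
have W (f g : form1 P) (sf : smooth_form f) (sg : smooth_form g) :=
  dform2_wedge v1 v2 v3 (smooth_diff sf) (smooth_diff sg).
have L := smooth_closed v1 v2 v3 (so al i).
have := dform2D (dform2D (dform2D
    (dform2_sum (fun j => W _ _ (so al j) (sq j i)))
    (dform2_sum (fun be => W _ _ (sp al be) (so be i))))
    (W _ _ sh (so al i)))
  (dform2_sum (fun be => dform2_sum (fun j =>
     dform2_sum (fun ga => dform2_sum (fun k =>
       dform2M (pder_ta w1 i be ga al j k) (pder_ta w2 i be ga al j k)
         (pder_ta w3 i be ga al j k) (W _ _ (so be j) (so ga k))))))).
have N : \near y, forall v v',
  bil v v' (curl (lo (om D al i)) y) =
    \sum_j wedge2 (lo (om D al j)) (lo (omq D j i)) v v' y
    + \sum_be wedge2 (lo (omp D al be)) (lo (om D be i)) v v' y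
    + wedge2 (lo (om0 D)) (lo (om D al i)) v v' y
    + \sum_be \sum_j \sum_ga \sum_k ta D (chart_inv c y) i be ga al j k
        * wedge2 (lo (om D be j)) (lo (om D ga k)) v v' y.
  have /= := open_nbhs_nbhs (conj (@open_chart_img _ _ _ c) Uy).
  by apply: filterS => z Uz v v'; exact: curl_om.
move=> /dform2_unique /(_ (dform2_near N L)).
rewrite [X in X + _ + _ + _](_ : _ = - cyclic (fun x y z => \sum_j x al j *
      form2 (fun ga k de l => tb1 D u i ga de j k l) y z) x1 x2 x3); last first.
  rewrite /cyclic -!big_split -sumrN; apply: eq_bigr => j _ /=.
  rewrite (curl_omq_at w1 w2) (curl_omq_at w2 w3) (curl_omq_at w3 w1).
  by rewrite !ox1 !ox2 !ox3 qx1 qx2 qx3; ring.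
rewrite [X in _ + X + _ + _](_ : _ = cyclic (fun x y z => \sum_be
      form2 (fun ga k de l => tb2 D u be ga de al k l) x y * z be i) x1 x2 x3); last first.
  rewrite /cyclic -!big_split; apply: eq_bigr => be _ /=.
  rewrite (curl_omp_at w1 w2) (curl_omp_at w2 w3) (curl_omp_at w3 w1).
  by rewrite !ox1 !ox2 !ox3 px1 px2 px3; ring.
rewrite (curl_om0_at w1 w2) (curl_om0_at w2 w3) (curl_om0_at w3 w1) hx1 hx2 hx3.
rewrite [X in _ + X = 0 -> _](_ : _ = cyclic (torsion_part (ta D u) a' al i) x1 x2 x3).
  by move=> E; rewrite -[RHS]E /cyclic; ring.
rewrite /cyclic /torsion_part yu.
do 4!(rewrite -!big_split; apply: eq_bigr => ? _) => /=.
rewrite !(curl_om_at w1 w2) !(curl_om_at w2 w3) !(curl_om_at w3 w1).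
by rewrite /wedge2 !ox1 !ox2 !ox3; ring.
Qed.

End FirstBianchi.

Theorem theorem4p2 (R : realType) (p q : nat) (hp : (2 < p)%N) (hq : (2 < q)%N) :
  exists (F1 : 'I_q -> 'I_p -> 'I_p -> 'I_q -> 'I_q -> 'I_q ->
               formula (torsion_var p q))
         (F2 : 'I_p -> 'I_p -> 'I_p -> 'I_p -> 'I_q -> 'I_q ->
               formula (torsion_var p q)),
  forall (M : manifold R (p * q)) (S : AG_structure M) (B : frame_bundle S)
         (u : bundle B)
         (a' : 'I_q -> 'I_p -> 'I_p -> 'I_p -> 'I_p -> 'I_q -> 'I_q -> 'I_q -> R),
    (forall i be ga al j k,
       pfaffian B u (fun w => ta B w i be ga al j k)
                    (fun de l => a' i be ga de al j k l)) ->
    (forall i ga de j k l,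
       tb1 B u i ga de j k l
       = eval_formula (torsion_env (ta B u) a') (F1 i ga de j k l)) /\
    (forall be ga de al k l,
       tb2 B u be ga de al k l
       = eval_formula (torsion_env (ta B u) a') (F2 be ga de al k l)).
Proof.
have /choice [F1 E1] : forall s : 'I_q * 'I_p * 'I_p * 'I_q * 'I_q * 'I_q,
    exists F, forall t : torsion_jet R p q,
      let: (i, ga, de, j, k, l) := s in
      jb1 t i ga de j k l = eval_formula (jenv t) F.
  by move=> [[[[[i ga] de] j] k] l]; exact: expressible_jb1.
have /choice [F2 E2] : forall s : 'I_p * 'I_p * 'I_p * 'I_p * 'I_q * 'I_q,
    exists F, forall t : torsion_jet R p q,
      let: (be, ga, de, al, k, l) := s in
      jb2 t be ga de al k l = eval_formula (jenv t) F.
  by move=> [[[[[be ga] de] al] k] l]; exact: expressible_jb2.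
exists (fun i ga de j k l => F1 (i, ga, de, j, k, l)).
exists (fun be ga de al k l => F2 (be, ga, de, al, k, l)).
move=> M S B u a' der; have [b2s b1s b2t b1t bn] : b_conditions B u by exact: data_b.
have ind : independent B u by exact: data_independent.
have eqs : structure_equations B by exact: data_equations.
have bia := first_bianchi (data_smooth B) eqs ind der.
pose t := TorsionJet b2s b1s b2t b1t bn bia.
split=> [i ga de j k l|be ga de al k l].
  exact: (E1 (i, ga, de, j, k, l) t).
exact: (E2 (be, ga, de, al, k, l) t).
Qed.
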